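(* Let $\ell$ be a field. If $R$ is a unital, purely infinite simple and $K_1$-regular $\ell$-algebra, then $K_1(R)=\pi_0(U(R))$; that is, the canonical map $U(R)\to K_1(R)$ induces an isomorphism $\pi_0(U(R))\cong K_1(R)$.
   Context: A unital ring is purely infinite simple iff it is not a division ring and for every nonzero $x$ there are $a,b$ with $axb=1$. $R$ is $K_1$-regular if the canonical map $K_1(R)\to K_1(R[t_1,\dots,t_m])$ is an isomorphism for every $m$. $U(R)$ is the group of invertible elements of $R$. $U(R)^0\subset U(R)$ is the normal subgroup of those $g$ for which there is $u(t)\in U(R[t])$ with $u(0)=1$ and $u(1)=g$, and $\pi_0(U(R))=U(R)/U(R)^0$. *)

(* Defs.v *)
From HB Require Import structures.
From mathcomp Require Import mpoly.
From mathcomp Require Import all_boot all_algebra.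
From mathcomp Require Import boolp classical_sets fsbigop.

Set Implicit Arguments.
Unset Strict Implicit.
Unset Printing Implicit Defensive.

Import GRing.Theory.
Local Open Scope quotient_scope.
Local Open Scope classical_set_scope.
Local Open Scope group_scope.

Section Subgroups.
Variable G : groupType.

Definition is_subgroup (H : set G) : Prop :=
  [/\ H 1, forall x y, H x -> H y -> H (x * y) & forall x, H x -> H x^-1].

Record normalSubgroup := NormalSubgroup {
  nsub_set :> G -> Prop;
  nsub_subgroup : is_subgroup nsub_set;
  nsub_conj : forall x y, nsub_set x -> nsub_set (x ^ y) }.

Lemma nsub1 (N : normalSubgroup) : N 1. Proof. by case: (nsub_subgroup N). Qed.

Lemma nsubM (N : normalSubgroup) x y : N x -> N y -> N (x * y).
Proof. by case: (nsub_subgroup N) => _ + _; apply. Qed.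

Lemma nsubV (N : normalSubgroup) x : N x -> N x^-1.
Proof. by case: (nsub_subgroup N) => _ _; apply. Qed.

Definition derived_set : set G :=
  smallest is_subgroup [set g | exists x y : G, g = commg x y].

Lemma derived_subgroup : is_subgroup derived_set.
Proof.
split=> [H [[H1 _ _] _] // | x y Hx Hy H HH | x Hx H HH].
- by case: (HH) => -[_ HM _] _; apply: HM; [exact: Hx|exact: Hy].
- by case: (HH) => -[_ _ HV] _; apply: HV; exact: Hx.
Qed.

Lemma derived_conj x y : derived_set x -> derived_set (x ^ y).
Proof.
move=> Dx; have -> : x ^ y = x * commg x y by rewrite /commg mulVKg.
have [_ DM _] := derived_subgroup; apply: DM => // H [_]; apply.
by exists x, y.
Qed.

Definition derived : normalSubgroup :=
  NormalSubgroup derived_subgroup derived_conj.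

End Subgroups.

Lemma morphV_of_M (G H : groupType) (h : G -> H) :
  {morph h : x y / x * y} -> {morph h : x / x^-1}.
Proof.
move=> hM x; have h1 : h 1 = 1.
  by rewrite -[LHS](mulKg (h 1)) -hM mulg1 mulVg.
by rewrite -[LHS](mulgK (h x)) -hM mulVg h1 mul1g.
Qed.

Lemma derived_morph (G H : groupType) (h : G -> H) (x : G) :
  {morph h : x y / x * y} -> derived G x -> derived H (h x).
Proof.
move=> hM Dx; have hV := morphV_of_M hM.
have [D1 DM DV] := derived_subgroup H.
apply: (Dx (fun y => derived H (h y))); split.
  split=> [|y z Dy Dz|y Dy]; last by rewrite hV; exact: DV.
    by rewrite -(mulgV x) hM hV mulgV.
  by rewrite hM; exact: DM.
move=> _ [y [z ->]]; rewrite /= /commg /conjg !(hM, hV) => K [_]; apply.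
by exists (h y), (h z).
Qed.

Section Quotient.
Variables (G : groupType) (N : normalSubgroup G).

Definition nsub_rel : rel G := fun x y => `[< N (x^-1 * y) >].

Lemma nsub_rel_refl : reflexive nsub_rel.
Proof. by move=> x; apply/asboolP; rewrite mulVg; exact: nsub1. Qed.

Lemma nsub_rel_sym : symmetric nsub_rel.
Proof.
move=> x y; apply/asboolP/asboolP => /nsubV; by rewrite invgM invgK.
Qed.

Lemma nsub_rel_trans : transitive nsub_rel.
Proof.
move=> y x z /asboolP Nxy /asboolP Nyz; apply/asboolP.
by have := nsubM Nxy Nyz; rewrite -mulgA mulVKg.
Qed.

Canonical nsub_equiv :=
  EquivRel nsub_rel nsub_rel_refl nsub_rel_sym nsub_rel_trans.

Definition quot : Type := {eq_quot nsub_rel}.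

HB.instance Definition _ := Choice.on quot.

Definition qpi (x : G) : quot := \pi_({eq_quot nsub_rel})%qT x.

Definition qrepr (q : quot) : G := repr (q : {eq_quot nsub_rel}).

Lemma qreprK q : qpi (qrepr q) = q. Proof. exact: reprK. Qed.

Lemma qpiP x y : qpi x = qpi y <-> N (x^-1 * y).
Proof.
split=> [/eqquotP /asboolP // | Nxy].
by apply/eqquotP/asboolP.
Qed.

Definition qone : quot := qpi 1.
Definition qmul (p q : quot) : quot := qpi (qrepr p * qrepr q).
Definition qinv (q : quot) : quot := qpi (qrepr q)^-1.

Lemma qpiM x y : qmul (qpi x) (qpi y) = qpi (x * y).
Proof.
apply/qpiP; set x' := qrepr _; set y' := qrepr _.
have /qpiP Nx : qpi x' = qpi x by exact: qreprK.
have /qpiP Ny : qpi y' = qpi y by exact: qreprK.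
have -> : (x' * y')^-1 * (x * y) = ((x'^-1 * x) ^ y') * (y'^-1 * y).
  by rewrite /conjg invgM !mulgA mulgK.
by apply: nsubM => //; exact: nsub_conj.
Qed.

Lemma qpiV x : qinv (qpi x) = qpi x^-1.
Proof.
apply/qpiP; set x' := qrepr _; rewrite invgK.
have /qpiP Nx : qpi x = qpi x' by rewrite qreprK.
have -> : x' * x^-1 = (x^-1 * x') ^ x^-1 by rewrite /conjg invgK mulgA mulVKg.
exact: nsub_conj.
Qed.

Lemma qmulA : associative qmul.
Proof.
move=> p q r; rewrite -(qreprK p) -(qreprK q) -(qreprK r).
by rewrite !qpiM mulgA.
Qed.

Lemma qmul1 : left_id qone qmul.
Proof. by move=> p; rewrite -(qreprK p) qpiM mul1g. Qed.

Lemma q1mul : right_id qone qmul.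
Proof. by move=> p; rewrite -(qreprK p) qpiM mulg1. Qed.

Lemma qmulV : left_inverse qone qinv qmul.
Proof. by move=> p; rewrite -(qreprK p) qpiV qpiM mulVg. Qed.

Lemma qVmul : right_inverse qone qinv qmul.
Proof. by move=> p; rewrite -(qreprK p) qpiV qpiM mulgV. Qed.

HB.instance Definition _ := isGroup.Build quot qmulA qmul1 q1mul qmulV qVmul.

Lemma qpi_monoid_morphism : monoid.monoid_morphism qpi.
Proof. by split=> // x y; rewrite -qpiM. Qed.

HB.instance Definition _ := isUMagmaMorphism.Build G quot qpi
  qpi_monoid_morphism.

End Quotient.

Local Open Scope ring_scope.

Section Units.
Variable R : pzRingType.

(* U(R). GRing.unit needs a unitRingType, a structure that {poly R} and 'M[R]_n
   do not carry when R is not commutative. *)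
Record units := Units {
  uval : R;
  uinv : R;
  uvalV : uval * uinv = 1;
  uVval : uinv * uval = 1 }.

Lemma uval_inj : injective uval.
Proof.
move=> [x x' xx' x'x] [y y' yy' y'y] /= exy; subst y.
have ex' : x' = y' by rewrite -[x']mulr1 -yy' mulrA x'x mul1r.
by subst y'; congr Units; exact: Prop_irrelevance.
Qed.

HB.instance Definition _ := gen_eqMixin units.
HB.instance Definition _ := gen_choiceMixin units.

Definition uone : units := Units (mulr1 1) (mulr1 1).

Definition uinvert (x : units) : units := Units (uVval x) (uvalV x).

Lemma umul_subproof1 (x y : units) :
  (uval x * uval y) * (uinv y * uinv x) = 1.
Proof. by rewrite mulrA -(mulrA (uval x)) uvalV mulr1 uvalV. Qed.

Lemma umul_subproof2 (x y : units) :
  (uinv y * uinv x) * (uval x * uval y) = 1.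
Proof. by rewrite mulrA -(mulrA (uinv y)) uVval mulr1 uVval. Qed.

Definition umul (x y : units) : units :=
  Units (umul_subproof1 x y) (umul_subproof2 x y).

Lemma umulA : associative umul.
Proof. by move=> x y z; apply: uval_inj; rewrite /= mulrA. Qed.

Lemma umul1 : left_id uone umul.
Proof. by move=> x; apply: uval_inj; rewrite /= mul1r. Qed.

Lemma u1mul : right_id uone umul.
Proof. by move=> x; apply: uval_inj; rewrite /= mulr1. Qed.

Lemma umulV : left_inverse uone uinvert umul.
Proof. by move=> x; apply: uval_inj; rewrite /= uVval. Qed.

Lemma uVmul : right_inverse uone uinvert umul.
Proof. by move=> x; apply: uval_inj; rewrite /= uvalV. Qed.

HB.instance Definition _ := isGroup.Build units umulA umul1 u1mul umulV uVmul.

End Units.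

Section UnitsMap.
Variables (R S : pzRingType) (f : {rmorphism R -> S}).

Definition umap (x : units R) : units S :=
  @Units S (f (uval x)) (f (uinv x))
    (etrans (esym (rmorphM f _ _)) (etrans (congr1 f (uvalV x)) (rmorph1 f)))
    (etrans (esym (rmorphM f _ _)) (etrans (congr1 f (uVval x)) (rmorph1 f))).

End UnitsMap.

Section Homotopy.
Variable R : nzRingType.

(* U(R)^0 *)
Definition units0_set : set (units R) :=
  [set g | exists u : units {poly R}, (uval u).[0] = 1 /\ (uval u).[1] = uval g].

(* Evaluation at a central element is multiplicative over any ring. *)
Lemma horner0M (p q : {poly R}) : (p * q).[0] = p.[0] * q.[0].
Proof. by apply: hornerM_comm; rewrite /comm_poly mulr0 mul0r. Qed.

Lemma horner1M (p q : {poly R}) : (p * q).[1] = p.[1] * q.[1].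
Proof. by apply: hornerM_comm; rewrite /comm_poly mulr1 mul1r. Qed.

Lemma units0_subgroup : is_subgroup units0_set.
Proof.
split=> [|g h [u [u0 u1]] [v [v0 v1]]|g [u [u0 u1]]].
- by exists 1%g; rewrite !hornerC.
- exists (u * v)%g; rewrite /= horner0M horner1M u0 v0 u1 v1.
  by rewrite mulr1.
- exists (u^-1)%g => /=; split.
    have /(congr1 (fun p => p.[0])) := uvalV u.
    by rewrite horner0M u0 mul1r hornerC.
  have /(congr1 (fun p => p.[1])) := uvalV u; rewrite horner1M u1 hornerC => e.
  by rewrite -[LHS]mul1r -{1}(uVval g) -mulrA e mulr1.
Qed.

Lemma units0_conj (x y : units R) : units0_set x -> units0_set (x ^ y)%g.
Proof.
move=> [u [u0 u1]].
exists (u ^ umap polyC y)%g; rewrite /= !(horner0M, horner1M) u0 u1 !hornerC.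
by rewrite mul1r uVval.
Qed.

Definition units0 : normalSubgroup (units R) :=
  NormalSubgroup units0_subgroup units0_conj.

Definition pi0U : groupType := quot units0.

End Homotopy.

Section GL.
Variable R : pzRingType.

(* The infinite matrix diag(A, 1, 1, ...). *)
Definition stabmx n (A : 'M[R]_n) : nat -> nat -> R :=
  fun i j => if insub i is Some i' then
               if insub j is Some j' then A i' j' else (i == j)%:R
             else (i == j)%:R.

Definition infmul (A B : nat -> nat -> R) : nat -> nat -> R :=
  fun i k => \sum_(j \in [set: nat]) A i j * B j k.

Lemma stabmx_ord n (A : 'M[R]_n) (i j : 'I_n) : stabmx A i j = A i j.
Proof. by rewrite /stabmx !valK. Qed.

Lemma stabmx_out n (A : 'M[R]_n) i j :
  (n <= i)%N || (n <= j)%N -> stabmx A i j = (i == j)%:R.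
Proof.
rewrite /stabmx; case: insubP => [i' _ <-|//].
case: insubP => [j' _ <-|//].
by rewrite leqNgt ltn_ord leqNgt ltn_ord.
Qed.

Lemma stabmx_inj n : injective (@stabmx n).
Proof. by move=> A B e; apply/matrixP => i j; rewrite -!stabmx_ord e. Qed.

Lemma stabmx1 n : stabmx (1%:M : 'M[R]_n) = fun i j => (i == j)%:R.
Proof.
apply/funext => i; apply/funext => j.
have [h|] := boolP ((n <= i)%N || (n <= j)%N); first by rewrite stabmx_out.
rewrite negb_or -!ltnNge => /andP[hi hj].
by rewrite (stabmx_ord _ (Ordinal hi) (Ordinal hj)) mxE.
Qed.

Lemma stabmx_mul n (A B : 'M[R]_n) :
  infmul (stabmx A) (stabmx B) = stabmx (A *m B).
Proof.
apply/funext => i; apply/funext => k; rewrite /infmul.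
have [hi|hi] := leqP n i.
  rewrite -(fsbig_widen [set i]) //=; last first.
    move=> j [_ /= ji]; rewrite stabmx_out ?hi //.
    by case: eqP => [e|_]; [case: ji; rewrite e | rewrite mul0r].
  by rewrite fsbig_set1 !stabmx_out ?hi // eqxx mul1r.
have [hk|hk] := leqP n k.
  rewrite -(fsbig_widen [set k]) //=; last first.
    move=> j [_ /= jk]; rewrite [stabmx B _ _]stabmx_out ?hk ?orbT //.
    by case: eqP => [e|_]; [case: jk; rewrite e | rewrite mulr0].
  by rewrite fsbig_set1 !stabmx_out ?hk ?orbT // eqxx mulr1.
rewrite (stabmx_ord _ (Ordinal hi) (Ordinal hk)) mxE.
rewrite -(fsbig_widen `I_n) //=; last first.
  move=> j [_ /= /negP]; rewrite -leqNgt => hj.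
  rewrite stabmx_out ?hj ?orbT //; case: eqP => [e|_]; last by rewrite mul0r.
  by move: hi; rewrite e ltnNge hj.
rewrite -fsbig_ord; apply: eq_bigr => j _.
by rewrite -(stabmx_ord A) -(stabmx_ord B).
Qed.

(* GL(R), the union of the groups GL_n(R) along A |-> diag(A, 1): invertible
   infinite matrices of the form diag(A, 1, 1, ...), packed with their inverse. *)
Record GL := MkGL {
  glmx : nat -> nat -> R;
  glinv : nat -> nat -> R;
  glP : exists n (A : units 'M[R]_n),
    glmx = stabmx (uval A) /\ glinv = stabmx (uinv A) }.

Lemma stabmx_widen n N (A : units 'M[R]_n) : (n <= N)%N ->
  exists B : units 'M[R]_N,
    stabmx (uval A) = stabmx (uval B) /\ stabmx (uinv A) = stabmx (uinv B).
Proof.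
move=> nN; pose tr (M : 'M[R]_n) : 'M[R]_N := \matrix_(i, j) stabmx M i j.
have trE M : stabmx (tr M) = stabmx M.
  apply/funext => i; apply/funext => j.
  have [h|] := boolP ((N <= i)%N || (N <= j)%N).
    rewrite !stabmx_out //.
    by case/orP: h => /(leq_trans nN) ->; rewrite ?orbT.
  rewrite negb_or -!ltnNge => /andP[hi hj].
  by rewrite (stabmx_ord _ (Ordinal hi) (Ordinal hj)) mxE.
have trM (M M' : 'M[R]_n) : M *m M' = 1%:M -> tr M *m tr M' = 1%:M.
  by move=> e; apply: stabmx_inj; rewrite -stabmx_mul !trE stabmx_mul e !stabmx1.
exists (@Units 'M[R]_N _ _ (trM _ _ (uvalV A)) (trM _ _ (uVval A))).
by rewrite /= !trE.
Qed.

Definition GLn n (A : units 'M[R]_n) : GL :=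
  MkGL (ex_intro _ n (ex_intro _ A (conj erefl erefl))).

Lemma GL_ind2 (g h : GL) : exists n (A B : units 'M[R]_n),
  [/\ glmx g = stabmx (uval A), glinv g = stabmx (uinv A),
      glmx h = stabmx (uval B) & glinv h = stabmx (uinv B)].
Proof.
have [n [A [-> ->]]] := glP g; have [m [B [-> ->]]] := glP h.
have [A' [-> ->]] := stabmx_widen A (leq_maxl n m).
have [B' [-> ->]] := stabmx_widen B (leq_maxr n m).
by exists (maxn n m), A', B'.
Qed.

Lemma glmx_inj : injective glmx.
Proof.
move=> g h e; have [n [A [B [gA gA' hB hB']]]] := GL_ind2 g h.
have AB : A = B by apply: uval_inj; apply: stabmx_inj; rewrite -gA -hB.
have e' : glinv g = glinv h by rewrite gA' hB' AB.
case: g h e e' {gA gA' hB hB'} => [g g' Hg] [h h' Hh] /= e e'.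
by subst h h'; congr MkGL; exact: Prop_irrelevance.
Qed.

Lemma GLnP (g : GL) : exists n (A : units 'M[R]_n), g = GLn A.
Proof.
by have [n [A [gA _]]] := glP g; exists n, A; apply: glmx_inj; rewrite gA.
Qed.

Lemma GLnP2 (g h : GL) : exists n (A B : units 'M[R]_n), g = GLn A /\ h = GLn B.
Proof.
have [n [A [B [gA _ hB _]]]] := GL_ind2 g h.
by exists n, A, B; split; apply: glmx_inj; rewrite ?gA ?hB.
Qed.

HB.instance Definition _ := gen_eqMixin GL.
HB.instance Definition _ := gen_choiceMixin GL.

Lemma gl_mul_subproof (g h : GL) : exists n (A : units 'M[R]_n),
  infmul (glmx g) (glmx h) = stabmx (uval A) /\
  infmul (glinv h) (glinv g) = stabmx (uinv A).
Proof.
have [n [A [B [-> -> -> ->]]]] := GL_ind2 g h.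
by exists n, (umul A B); rewrite !stabmx_mul.
Qed.

Lemma gl_inv_subproof (g : GL) : exists n (A : units 'M[R]_n),
  glinv g = stabmx (uval A) /\ glmx g = stabmx (uinv A).
Proof. by have [n [A [-> ->]]] := glP g; exists n, (uinvert A). Qed.

Definition gl_one : GL := GLn (uone 'M[R]_0).
Definition gl_mul (g h : GL) : GL := MkGL (gl_mul_subproof g h).
Definition gl_inv (g : GL) : GL := MkGL (gl_inv_subproof g).

Lemma GLn1 n : GLn (uone 'M[R]_n) = gl_one.
Proof. by apply: glmx_inj; rewrite /= !stabmx1. Qed.

Lemma GLnM n (A B : units 'M[R]_n) : gl_mul (GLn A) (GLn B) = GLn (umul A B).
Proof. by apply: glmx_inj; rewrite /= stabmx_mul. Qed.

Lemma GLnV n (A : units 'M[R]_n) : gl_inv (GLn A) = GLn (uinvert A).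
Proof. exact: glmx_inj. Qed.

Lemma gl_mulA : associative gl_mul.
Proof.
move=> f g h; apply: glmx_inj.
have [n [F [G [fF gG]]]] := GLnP2 f g; have [m [H hH]] := GLnP h.
have [F' [eF _]] := stabmx_widen F (leq_maxl n m).
have [G' [eG _]] := stabmx_widen G (leq_maxl n m).
have [H' [eH _]] := stabmx_widen H (leq_maxr n m).
by rewrite fF gG hH /= eF eG eH !stabmx_mul mulmxA.
Qed.

Lemma gl_mul1 : left_id gl_one gl_mul.
Proof.
by move=> g; have [n [A ->]] := GLnP g; rewrite -(GLn1 n) GLnM umul1.
Qed.

Lemma gl_1mul : right_id gl_one gl_mul.
Proof.
by move=> g; have [n [A ->]] := GLnP g; rewrite -(GLn1 n) GLnM u1mul.
Qed.

Lemma gl_mulV : left_inverse gl_one gl_inv gl_mul.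
Proof.
by move=> g; have [n [A ->]] := GLnP g; rewrite GLnV GLnM umulV GLn1.
Qed.

Lemma gl_Vmul : right_inverse gl_one gl_inv gl_mul.
Proof.
by move=> g; have [n [A ->]] := GLnP g; rewrite GLnV GLnM uVmul GLn1.
Qed.

HB.instance Definition _ :=
  isGroup.Build GL gl_mulA gl_mul1 gl_1mul gl_mulV gl_Vmul.

(* K_1(R) = GL(R) / [GL(R), GL(R)]. *)
Definition K1 : groupType := quot (derived GL).

(* The canonical map U(R) -> GL(R) -> K_1(R), through GL_1(R). *)
Definition U_GL (u : units R) : GL :=
  GLn (@Units 'M[R]_1 (uval u)%:M (uinv u)%:M
    (etrans (esym (scalar_mxM _ _ _)) (congr1 scalar_mx (uvalV u)))
    (etrans (esym (scalar_mxM _ _ _)) (congr1 scalar_mx (uVval u)))).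

Lemma U_GLM : {morph U_GL : u v / (u * v)%g}.
Proof.
move=> u v; rewrite [RHS]GLnM; congr GLn.
by apply: uval_inj; rewrite /= scalar_mxM.
Qed.

Definition U_K1 (u : units R) : K1 := qpi (derived GL) (U_GL u).

Lemma U_K1M : {morph U_K1 : u v / (u * v)%g}.
Proof. by move=> u v; rewrite /U_K1 U_GLM gmulfM. Qed.

End GL.

Section Functoriality.
Variables (R S : pzRingType) (f : {rmorphism R -> S}).

Lemma map_stabmx n (M : 'M[R]_n) :
  (fun i j => f (stabmx M i j)) = stabmx (map_mx f M).
Proof.
apply/funext => i; apply/funext => j; rewrite /stabmx.
by case: insub => [?|]; [case: insub => [?|]|]; rewrite ?mxE ?rmorph_nat.
Qed.

Lemma GLmap_subproof (g : GL R) : exists n (A : units 'M[S]_n),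
  (fun i j => f (glmx g i j)) = stabmx (uval A) /\
  (fun i j => f (glinv g i j)) = stabmx (uinv A).
Proof.
have [n [A [-> ->]]] := glP g; exists n, (umap (map_mx f) A).
by rewrite !map_stabmx.
Qed.

Definition GLmap (g : GL R) : GL S := MkGL (GLmap_subproof g).

Definition K1map (x : K1 R) : K1 S := qpi (derived (GL S)) (GLmap (qrepr x)).

Lemma GLmap_GLn n (A : units 'M[R]_n) : GLmap (GLn A) = GLn (umap (map_mx f) A).
Proof. by apply: glmx_inj; rewrite /= map_stabmx. Qed.

Lemma GLmapM : {morph GLmap : g h / (g * h)%g}.
Proof.
move=> g h; have [n [A [B [-> ->]]]] := GLnP2 g h.
rewrite [(GLn A * GLn B)%g]GLnM !GLmap_GLn [RHS]GLnM; congr GLn.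
by apply: uval_inj; rewrite /= map_mxM.
Qed.

Lemma K1mapE (g : GL R) :
  K1map (qpi (derived (GL R)) g) = qpi (derived (GL S)) (GLmap g).
Proof.
apply/qpiP; rewrite -(morphV_of_M GLmapM) -GLmapM.
by apply: (derived_morph GLmapM); apply/qpiP; rewrite qreprK.
Qed.

Lemma K1mapM : {morph K1map : x y / (x * y)%g}.
Proof.
move=> x y; rewrite -(qreprK x) -(qreprK y) -gmulfM !K1mapE GLmapM.
by rewrite gmulfM.
Qed.

HB.instance Definition _ := isGroupMorphism.Build (K1 R) (K1 S) K1map
  (fun x y => etrans (K1mapM x y^-1%g)
                     (congr1 _ (morphV_of_M K1mapM y))).

End Functoriality.

(* K1map is a group morphism, so bijectivity means isomorphism; the variables of
   {mpoly R[m]} commute with R. *)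
Definition K1_regular (R : nzRingType) : Prop :=
  forall m : nat, bijective (K1map (@mpolyC m R)).

(* 1 != 0 is part of nzRingType. *)
Definition division_ring (R : nzRingType) : Prop :=
  forall x : R, x != 0 -> exists y : R, x * y = 1 /\ y * x = 1.

Definition purely_infinite_simple (R : nzRingType) : Prop :=
  ~ division_ring R /\
  forall x : R, x != 0 -> exists a b : R, a * x * b = 1.

(* Main.v *)
(** A purely infinite simple ring contains isometries: elements [s1], [s2] with left
inverses [t1], [t2] such that [t1 s2 = t2 s1 = 0]. If [t s = 1] then
[x |-> 1 - st + sxt] embeds [U(R)] in itself; orthogonal isometries give the same
map into [pi_0 U(R)], since a rotation, which is a product of transvections
[1 + z] with [z^2 = 0], carries one to the other. Every unit can be moved by
transvections into the corner of an isometry, so the embedding given by [s1] is the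
identity on [pi_0 U(R)]; as corners of [s1] and [s2] commute, [pi_0 U(R)] is abelian.
Likewise a row [s] of [n] orthogonal isometries, with [t s = I_n], gives a morphism
[A |-> 1 - st + sAt] from [GL_n(R)] to [U(R)]. Into the abelian group [pi_0 U(R)]
it kills commutators, whence the injectivity of [pi_0 U(R) -> K_1(R)]; and
[diag(1 - st + sAt, 1)] is conjugate to [diag(A, 1)], whence the surjectivity.
Regularity is only used for the map to be well defined: both evaluations at [0] and
at [1] invert [K_1(R) -> K_1(R[t])], so they agree. *)

Require Import Defs.
From HB Require Import structures.
From mathcomp Require Import mpoly.
From mathcomp Require Import all_boot all_algebra.
From mathcomp Require Import boolp.

Set Implicit Arguments.
Unset Strict Implicit.
Unset Printing Implicit Defensive.

Import GRing.Theory.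
Local Open Scope ring_scope.

(** * Unit groups of corners *)

Section CornerUnit.
Variables (S R : pzRingType) (f : S -> R).
Hypothesis fM : {morph f : a b / a * b}.

Let F a := 1 - f 1 + f a.

(** [f] need not preserve [1] or sums: [1 - f 1] is an idempotent annihilating every [f c] on both
    sides, so the cross terms vanish. *)
Lemma corner_mul a b : F a * F b = F (a * b).
Proof.
have fl c : (1 - f 1) * f c = 0 by rewrite mulrBl mul1r -fM mul1r subrr.
have fr c : f c * (1 - f 1) = 0 by rewrite mulrBr mulr1 -fM mulr1 subrr.
have ee : (1 - f 1) * (1 - f 1) = 1 - f 1 by rewrite mulrBr mulr1 fl subr0.
rewrite /F; move: (1 - f 1) fl fr ee => e fl fr ee.
by rewrite mulrDl !mulrDr fl fr ee add0r addr0 -fM.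
Qed.

Lemma corner1 : F 1 = 1. Proof. exact: subrK. Qed.

Definition corner_unit (x : units S) : units R :=
  Units (etrans (corner_mul (uval x) (uinv x)) (etrans (congr1 F (uvalV x)) corner1))
        (etrans (corner_mul (uinv x) (uval x)) (etrans (congr1 F (uVval x)) corner1)).

Lemma corner_unitM : {morph corner_unit : x y / (x * y)%g}.
Proof. by move=> x y; apply: uval_inj; rewrite /= corner_mul. Qed.

End CornerUnit.

Lemma conj_morph (R : pzRingType) (s t : R) :
  t * s = 1 -> {morph (fun a => s * a * t) : a b / a * b}.
Proof. by move=> ts a b; rewrite !mulrA -(mulrA _ t s) ts mulr1. Qed.

Definition corner (R : pzRingType) (s t : R) (ts : t * s = 1) :=
  corner_unit (conj_morph ts).

Lemma uval_corner (R : pzRingType) (s t : R) (ts : t * s = 1) x :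
  uval (corner ts x) = 1 - s * t + s * uval x * t.
Proof. by rewrite /= mulr1. Qed.

Lemma corner_comp (R : pzRingType) (s t s' t' c d : R) (ts : t * s = 1)
    (ts' : t' * s' = 1) (dc : d * c = 1) x : c = s * s' -> d = t' * t ->
  corner ts (corner ts' x) = corner dc x.
Proof.
move=> cE dE; apply: uval_inj; rewrite !uval_corner cE dE.
rewrite !(mulrDr, mulrDl, mulrN, mulNr, mulr1) !mulrA addrA; congr (_ + _).
by rewrite addrA subrK.
Qed.

Lemma corner_commute (R : pzRingType) (s t r t' : R) (ts : t * s = 1)
    (t'r : t' * r = 1) x y : t * r = 0 -> t' * s = 0 ->
  (corner ts x * corner t'r y = corner t'r y * corner ts x)%g.
Proof.
(* In the form [1 + p(z - 1)q], both orders of the product lose their mixed term. *)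
move=> tr t's; have E p q (qp : q * p = 1) z :
    uval (corner qp z) = 1 + p * (uval z - 1) * q.
  by rewrite uval_corner mulrBr mulr1 mulrBl addrA addrAC.
apply: uval_inj; rewrite -[LHS]/(uval _ * uval _) -[RHS]/(uval _ * uval _) !E.
rewrite !(mulrDl, mulrDr, mul1r, mulr1) -!mulrA !(mulrA t) !(mulrA t').
by rewrite tr t's !mul0r !mulr0 !addr0 addrAC.
Qed.

(** The preimage is the compression [t v s]; with [e = 1 - st], the error term in its product with
    [t v^-1 s] dies because [te = 0]. *)
Lemma corner_surj (R : pzRingType) (s t : R) (ts : t * s = 1) (v : units R) :
  uval v * (1 - s * t) = 1 - s * t -> (1 - s * t) * uval v = 1 - s * t ->
  exists x, v = corner ts x.
Proof.
set e := 1 - s * t => ve ev.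
have st : s * t = 1 - e by rewrite opprB addrC subrK.
have te : t * e = 0 by rewrite mulrBr mulr1 mulrA ts mul1r subrr.
have ve' : uinv v * e = e by rewrite -{1}ve mulrA uVval mul1r.
have inv (a b : R) : a * b = 1 -> a * e = e -> (t * a * s) * (t * b * s) = 1.
  move=> ab ae; have -> : t * a * s * (t * b * s) = t * a * (s * t) * b * s.
    by rewrite !mulrA.
  by rewrite st mulrBr mulr1 -(mulrA t a e) ae te subr0 -(mulrA t) ab mulr1 ts.
exists (Units (inv _ _ (uvalV v) ve) (inv _ _ (uVval v) ve')).
apply: uval_inj; rewrite uval_corner -/e /=.
have -> : s * (t * uval v * s) * t = (s * t) * uval v * (s * t) by rewrite !mulrA.
rewrite st mulrBl mul1r ev mulrBr mulr1 mulrBl ve.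
have -> : e * e = e by rewrite {1}/e mulrBl mul1r -mulrA te mulr0 subr0.
by rewrite subrr subr0 addrC subrK.
Qed.

(** * Transvections and homotopy classes of units *)

Lemma square_zero_inv (R : pzRingType) (z : R) : z * z = 0 -> (1 + z) * (1 - z) = 1.
Proof. by move=> zz; rewrite mulrDl mul1r mulrBr mulr1 zz subr0 subrK. Qed.

Lemma square_zero_Vinv (R : pzRingType) (z : R) : z * z = 0 -> (1 - z) * (1 + z) = 1.
Proof. by move=> zz; rewrite mulrBl mul1r mulrDr mulr1 zz addr0 addrK. Qed.

Definition transvection (R : pzRingType) (z : R) (zz : z * z = 0) : units R :=
  Units (square_zero_inv zz) (square_zero_Vinv zz).

Section Homotopy.
Variable R : nzRingType.
Implicit Types u v x : units R.

Let cls u : pi0U R := qpi (units0 R) u.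

Lemma units0_cls1 u : units0 R u -> cls u = 1%g.
Proof.
move=> u0; rewrite -[RHS]/(cls 1%g); apply/esym/qpiP.
by rewrite invg1 mul1g.
Qed.

Lemma transvection_units0 (z : R) (zz : z * z = 0) : units0 R (transvection zz).
Proof.
have ZZ : z%:P * 'X * (z%:P * 'X) = 0.
  rewrite -mulrA (mulrA 'X) -(commr_polyX z%:P) !mulrA.
  by rewrite -polyCM zz polyC0 !mul0r.
exists (transvection ZZ) => /=.
by rewrite !hornerD !hornerC !hornerCM !hornerX mulr0 addr0 mulr1.
Qed.

Lemma cls_transvection (z : R) (zz : z * z = 0) u :
  cls (transvection zz * u)%g = cls u.
Proof.
by rewrite /cls gmulfM [X in (X * _)%g](units0_cls1 (transvection_units0 zz)) mul1g.
Qed.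

(* The rotation [w = (1 + rt)(1 - st')(1 + rt)] is a product of transvections
   carrying the corner of [s] to that of [r]. *)
Lemma corner_orthogonal (s t r t' : R) (ts : t * s = 1) (t'r : t' * r = 1) x :
  t * r = 0 -> t' * s = 0 -> cls (corner ts x) = cls (corner t'r x).
Proof.
move=> tr t's.
have z1 : (r * t) * (r * t) = 0 by rewrite mulrA -(mulrA r) tr mulr0 mul0r.
have z2 : (- (s * t')) * (- (s * t')) = 0.
  by rewrite mulrNN mulrA -(mulrA s) t's mulr0 mul0r.
pose w := (transvection z1 * (transvection z2 * transvection z1))%g.
have w1 : cls w = 1%g.
  by rewrite /w !cls_transvection; exact/units0_cls1/transvection_units0.
have ws : uval w * s = r.
  rewrite /= -!mulrA (mulrDl _ _ s) mul1r -!mulrA ts mulr1.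
  have -> : (1 - s * t') * (s + r) = r.
    by rewrite mulrBl mul1r -mulrA mulrDr t's t'r add0r mulr1 addrAC subrr add0r.
  by rewrite mulrDl mul1r -mulrA tr mulr0 addr0.
have t'w : t' * uval w = t.
  rewrite /= (mulrA t') (mulrA (t' * _)).
  have -> : t' * (1 + r * t) = t' + t by rewrite mulrDr mulr1 mulrA t'r mul1r.
  have -> : (t' + t) * (1 - s * t') = t.
    by rewrite mulrBr mulr1 mulrA mulrDl t's ts add0r mul1r addrAC subrr add0r.
  by rewrite mulrDr mulr1 mulrA tr mul0r addr0.
clearbody w.
have -> : cls (corner t'r x) = cls (w * corner ts x * w^-1)%g.
  congr cls; apply: (canRL (mulgK w)); apply: uval_inj.
  rewrite -[LHS]/(uval (corner t'r x) * uval w).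
  rewrite -[RHS]/(uval w * uval (corner ts x)) !uval_corner.
  rewrite mulrDl mulrBl mul1r -!mulrA t'w.
  by rewrite mulrDr mulrBr mulr1 !mulrA ws.
rewrite /cls !gmulfM gmulfV [X in (X * _ * _)%g]w1 [X in (_ * X^-1)%g]w1.
by rewrite invg1 mulg1 mul1g.
Qed.

Lemma corner_units0 (s t : R) (ts : t * s = 1) x :
  units0 R x -> units0 R (corner ts x).
Proof.
move=> [u [u0 u1]].
have tsP : t%:P * s%:P = 1 by rewrite -polyCM ts.
exists (corner tsP u); rewrite !uval_corner !(hornerD, hornerN, horner0M, horner1M).
by rewrite u0 u1 !hornerC mulr1 subrK.
Qed.

Lemma cls_corner (s t : R) (ts : t * s = 1) u v :
  cls u = cls v -> cls (corner ts u) = cls (corner ts v).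
Proof.
move=> /qpiP uv; apply/qpiP.
rewrite -(morphV_of_M (corner_unitM (conj_morph ts))) -corner_unitM.
exact: corner_units0.
Qed.

(* [u] fixes the image of the isometry [c], hence that of the idempotent
   [e = c (1 - s1 t1) d]; unlike [1 - cd], the complement of [e] is the range
   [st] of an isometry. *)
Lemma fixing_corner (s1 t1 c d : R) (ts1 : t1 * s1 = 1) (dc : d * c = 1) u :
  uval u * c = c ->
  exists s t (ts : t * s = 1) x,
    [/\ cls u = cls (corner ts x), s = 1 - c * d + c * s1 * d
      & t = 1 - c * d + c * t1 * d].
Proof.
move=> uc; pose s := 1 - c * d + c * s1 * d; pose t := 1 - c * d + c * t1 * d.
have mul a b : (1 - c * d + c * a * d) * (1 - c * d + c * b * d)
             = 1 - c * d + c * (a * b) * d.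
  by have /= := corner_mul (conj_morph dc) a b; rewrite !mulr1.
have ts : t * s = 1 by rewrite /t /s mul ts1 mulr1 subrK.
pose e := 1 - s * t.
have eE : e = c * (1 - s1 * t1) * d.
  by rewrite /e /t /s mul mulrBr mulr1 mulrBl opprD opprB addrA addrCA subrr addr0.
have ee : e * e = e.
  by rewrite /e mulrBr mulr1 mulrBl mul1r !mulrA -(mulrA s) ts mulr1 subrr subr0.
have ue : uval u * e = e by rewrite eE !mulrA uc.
(* As [ue = e], [u] is block upper triangular for [e] and [1 - e]; right multiplication by [1 + z]
   clears the off-diagonal block. *)
pose z := - (e * uval u * (1 - e)).
have ez : (1 - e) * e = 0 by rewrite mulrBl mul1r ee subrr.
have zz : z * z = 0.
  by rewrite /z mulrNN -!mulrA (mulrA (1 - e)) ez mul0r !mulr0.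
have [x xE] : exists x, (u * transvection zz)%g = corner ts x.
  apply: corner_surj; rewrite -/e /=.
    by rewrite -mulrA mulrDl mul1r /z mulNr -(mulrA _ (1 - e)) ez mulr0 subr0.
  rewrite mulrDr mulr1 mulrDr /z !mulrN !mulrA -(mulrA e _ e) ue ee.
  by rewrite mulrBr mulr1 -(mulrA e _ e) ue ee opprB addrC subrK.
exists s, t, ts, x; split=> //; rewrite -xE /cls gmulfM.
by rewrite [X in (_ * X)%g](units0_cls1 (transvection_units0 zz)) mulg1.
Qed.

(** * Commutativity of [pi0U R] *)

Section Isometries.
Variables s1 s2 t1 t2 : R.
Hypotheses (t1s1 : t1 * s1 = 1) (t2s2 : t2 * s2 = 1).
Hypotheses (t1s2 : t1 * s2 = 0) (t2s1 : t2 * s1 = 0).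
Hypothesis simple : forall x : R, x != 0 -> exists a b : R, a * x * b = 1.

Lemma exists_component_neq0 u :
  exists2 v, cls v = cls u & t2 * uval v * s1 != 0.
Proof.
have [c0|] := eqVneq (t2 * uval u * s1) 0; last by exists u.
(* Since [t2 u s1 = 0], the factor [1 - s2 t2] fixes [u s1]; hence [z u s1 = s2] and the new
   component is [1]. *)
pose z := s2 * t1 * uinv u * (1 - s2 * t2).
have zz : z * z = 0.
  rewrite /z -!mulrA (mulrA (1 - s2 * t2)) mulrBl mul1r -(mulrA s2) t2s2 mulr1.
  by rewrite subrr mul0r !mulr0.
exists (transvection zz * u)%g; first exact: cls_transvection.
suff -> : t2 * uval (transvection zz * u)%g * s1 = 1 by exact: oner_neq0.
rewrite /= mulrDl mul1r mulrDr mulrDl c0 add0r.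
have -> : t2 * (z * uval u) * s1
    = t2 * s2 * (t1 * uinv u * ((1 - s2 * t2) * (uval u * s1))).
  by rewrite /z !mulrA.
rewrite t2s2 mul1r mulrBl mul1r -(mulrA s2) (mulrA t2) c0 mulr0 subr0.
by rewrite -(mulrA t1) (mulrA (uinv u)) uVval mul1r t1s1.
Qed.

(* Transvections between the summands [s2 t2 R] and [(1 - s2 t2) R] bring
   the column [u s1 b] back to [s1 b]; this needs a left invertible component. *)
Lemma exists_fixing u :
  exists2 v, cls v = cls u &
    exists b d : R, d * b = 1 /\ uval v * (s1 * b) = s1 * b.
Proof.
have [u' <-] := exists_component_neq0 u.
move=> /simple [a [b]]; set d := a * _ => db.
pose w := uval u' * s1 * b.
have aw : a * t2 * w = 1 by rewrite /w !mulrA -(mulrA a) -(mulrA a) db.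
(* [a t2] is a left inverse of [w], so [1 + z1] changes the [1 - s2 t2] part of [w] to [s1 b]. *)
pose z1 := (1 - s2 * t2) * (s1 * b - w) * (a * t2).
have zz1 : z1 * z1 = 0.
  have t2q : t2 * (1 - s2 * t2) = 0 by rewrite mulrBr mulr1 mulrA t2s2 mul1r subrr.
  by rewrite /z1 -!mulrA (mulrA t2 (1 - _)) t2q mul0r !mulr0.
(* [d t1] is a left inverse of [s1 b] and [t1 s2 = 0], so [1 + z2] subtracts the remaining
   [s2 t2 w]. *)
pose z2 := - (s2 * t2 * w * d * t1).
have zz2 : z2 * z2 = 0.
  by rewrite /z2 mulrNN -!mulrA (mulrA t1) t1s2 mul0r !mulr0.
exists (transvection zz2 * (transvection zz1 * u'))%g.
  by rewrite !cls_transvection.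
exists b, d; split=> //.
have -> : uval (transvection zz2 * (transvection zz1 * u'))%g * (s1 * b)
          = (1 + z2) * ((1 + z1) * w) by rewrite /w /= !mulrA.
have z1w : (1 + z1) * w = s1 * b + s2 * t2 * w.
  have qy : (1 - s2 * t2) * (s1 * b - w) = s1 * b - w + s2 * t2 * w.
    rewrite mulrBl mul1r mulrBr -(mulrA s2 t2 (s1 * b)) (mulrA t2 s1) t2s1.
    by rewrite mul0r mulr0 sub0r opprK.
  by rewrite mulrDl mul1r /z1 -mulrA aw mulr1 qy addrA (addrC w) subrK.
clearbody d w.
rewrite z1w mulrDl mul1r /z2 mulNr mulrDr.
have -> : s2 * t2 * w * d * t1 * (s1 * b) = s2 * t2 * w.
  by rewrite -!mulrA (mulrA t1) t1s1 mul1r db mulr1.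
have -> : s2 * t2 * w * d * t1 * (s2 * t2 * w) = 0.
  by rewrite -!mulrA (mulrA t1) t1s2 mul0r !mulr0.
by rewrite addr0 addrK.
Qed.

(** The corners of [s1 s] and [s] carry the same [x], but these isometries need not be orthogonal.
    With [c = s1 b], the chain [s1 s], [s2], [c s2], [s] has orthogonal neighbours, the last pair
    because [t c = c t1]. *)
Lemma cls_corner_id u : cls (corner t1s1 u) = cls u.
Proof.
have [v vu [b [d [db vb]]]] := exists_fixing u.
rewrite -(cls_corner t1s1 vu) -vu.
have dc : (d * t1) * (s1 * b) = 1 by rewrite -mulrA (mulrA t1) t1s1 mul1r db.
have [s [t [ts [x [vx sE tE]]]]] := fixing_corner t1s1 dc vb.
rewrite (cls_corner t1s1 vx) vx.
have ts1 : (t * t1) * (s1 * s) = 1 by rewrite -mulrA (mulrA t1) t1s1 mul1r ts.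
rewrite (corner_comp t1s1 ts ts1) //.
have tr : t2 * (d * t1) * (s1 * b * s2) = 1.
  by rewrite -mulrA (mulrA (d * t1)) dc mul1r.
rewrite (@corner_orthogonal _ _ s2 t2 _ t2s2); last 2 first.
- by rewrite -mulrA t1s2 mulr0.
- by rewrite mulrA t2s1 mul0r.
rewrite -(@corner_orthogonal _ _ s2 t2 tr t2s2); last 2 first.
- by rewrite -!mulrA t1s2 !mulr0.
- by rewrite -!mulrA (mulrA t2 s1) t2s1 mul0r.
symmetry; apply: corner_orthogonal.
- have tc : t * (s1 * b) = s1 * b * t1.
    rewrite tE mulrDl mulrBl mul1r -(mulrA (s1 * b) (d * t1)) dc mulr1 subrr.
    by rewrite add0r -(mulrA _ (d * t1)) dc mulr1.
  by rewrite mulrA tc -mulrA t1s2 mulr0.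
- have ds : d * t1 * s = s1 * (d * t1).
    rewrite sE mulrDr mulrBr mulr1 (mulrA (d * t1) (s1 * b)) dc mul1r subrr add0r.
    by rewrite mulrA (mulrA (d * t1) (s1 * b)) dc mul1r.
  by rewrite -mulrA ds mulrA t2s1 mul0r.
Qed.

Lemma pi0_comm u v : (cls u * cls v = cls v * cls u)%g.
Proof.
rewrite -(cls_corner_id u) -(cls_corner_id v).
rewrite (corner_orthogonal t1s1 t2s2 v) // /cls -!gmulfM; congr qpi.
exact: corner_commute.
Qed.

End Isometries.
End Homotopy.

(** * Existence of two orthogonal isometries *)

Lemma exists_isometries (R : nzRingType) : purely_infinite_simple R ->
  exists s1 s2 t1 t2 : R,
    [/\ t1 * s1 = 1, t2 * s2 = 1, t1 * s2 = 0 & t2 * s1 = 0].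
Proof.
move=> [ndiv simple].
(* If every one-sided inverse were two-sided, [axb = 1] would make each nonzero [x] invertible. *)
have [s [t [ts st]]] : exists s t : R, t * s = 1 /\ s * t <> 1.
  apply: contra_notP ndiv => nst x /simple [a [b axb]].
  have fin (s t : R) : t * s = 1 -> s * t = 1.
    by move=> ts; apply: contra_notP nst => st; exists s, t.
  have xba : x * (b * a) = 1 by rewrite mulrA; apply: fin; rewrite mulrA.
  by exists (b * a); split=> //; apply: fin.
(* The nonzero idempotent [e = 1 - st] supplies the second isometry [eb], with left inverse [ae]; it
   is orthogonal to [s] as [te = es = 0]. *)
have /simple [a [b aeb]] : 1 - s * t != 0.
  by rewrite subr_eq0; apply/eqP => /esym.
pose e := 1 - s * t; have te : t * e = 0.
  by rewrite /e mulrBr mulr1 mulrA ts mul1r subrr.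
have es : e * s = 0 by rewrite /e mulrBl mul1r -mulrA ts mulr1 subrr.
have ee : e * e = e by rewrite {1}/e mulrBl mul1r -mulrA te mulr0 subr0.
exists s, (e * b), t, (a * e); split=> //.
- by rewrite mulrA -(mulrA a) ee.
- by rewrite mulrA te mul0r.
- by rewrite -mulrA es mulr0.
Qed.

(** * From [GL_n(R)] to [U(R)] *)

Section MatrixCorner.
Variable R : pzRingType.

Lemma conj_mx_morph n (s : 'rV[R]_n) (t : 'cV[R]_n) : t *m s = 1%:M ->
  {morph (fun A : 'M[R]_n => (s *m A *m t) 0 0) : A B / A * B}.
Proof.
move=> ts A B /=; have -> : s *m (A * B) *m t = (s *m A *m t) *m (s *m B *m t).
  by rewrite !mulmxA -(mulmxA _ t s) ts mulmx1.
by rewrite mxE big_ord1.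
Qed.

Definition mx_corner n (s : 'rV[R]_n) (t : 'cV[R]_n) (ts : t *m s = 1%:M) :=
  corner_unit (conj_mx_morph ts).

Lemma uval_mx_corner n (s : 'rV[R]_n) (t : 'cV[R]_n) (ts : t *m s = 1%:M) A :
  uval (mx_corner ts A) = 1 - (s *m t) 0 0 + (s *m uval A *m t) 0 0.
Proof. by rewrite /= -[X in s *m X](erefl 1%:M) mulmx1. Qed.

Variables s1 s2 t1 t2 : R.
Hypotheses (t1s1 : t1 * s1 = 1) (t2s2 : t2 * s2 = 1).
Hypotheses (t1s2 : t1 * s2 = 0) (t2s1 : t2 * s1 = 0).

(** Two isometries yield orthogonal families of every length. Index [0] gives [s1] itself, so that
    [diag(u, 1)] goes to the corner of [s1]. *)
Definition isometry_row n : 'rV[R]_n := \row_i (s2 ^+ i * s1).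
Definition isometry_col n : 'cV[R]_n := \col_i (t1 * t2 ^+ i).

Lemma isometry_colK n : isometry_col n *m isometry_row n = 1%:M.
Proof.
apply/matrixP => i j; rewrite mxE big_ord1 !mxE -val_eqE /=.
move: (i : nat) (j : nat); clear i j.
elim=> [|i IH] [|j].
- by rewrite expr0 mulr1 mul1r t1s1.
- by rewrite exprS mulr1 !mulrA t1s2 !mul0r.
- by rewrite exprSr mul1r -!mulrA t2s1 !mulr0.
- by rewrite exprSr exprS !mulrA -(mulrA _ t2 s2) t2s2 mulr1 -(mulrA _ _ s1) IH.
Qed.

End MatrixCorner.

(** * Stabilization and conjugation in [K_1(R)] *)

Section Stabilization.
Variable R : pzRingType.

Lemma GLn_inj n : injective (@GLn R n).
Proof. by move=> A B /(congr1 (@glmx R)) /stabmx_inj /uval_inj. Qed.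

Lemma GL_large (g : GL R) :
  exists n, forall N, (n <= N)%N -> exists A : units 'M[R]_N, g = GLn A.
Proof.
have [n [A ->]] := GLnP g; exists n => N nN.
have [B [AB _]] := stabmx_widen A nN.
by exists B; apply: glmx_inj.
Qed.

Lemma stabmx_block n m (A : 'M[R]_n) :
  stabmx (block_mx A 0 0 1%:M : 'M_(n + m)) = stabmx A.
Proof.
apply/funext => i; apply/funext => j.
have [h|] := boolP ((n + m <= i) || (n + m <= j))%N.
  rewrite !stabmx_out //.
  by case/orP: h => /(leq_trans (leq_addr m n)) ->; rewrite ?orbT.
rewrite negb_or -!ltnNge => /andP[hi hj].
rewrite (stabmx_ord _ (Ordinal hi) (Ordinal hj)).
have [i' /= ei|i' /= ei] := splitP (Ordinal hi);
  have [j' /= ej|j' /= ej] := splitP (Ordinal hj).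
- have -> : Ordinal hi = lshift m i' by exact: val_inj.
  have -> : Ordinal hj = lshift m j' by exact: val_inj.
  by rewrite block_mxEul ei ej stabmx_ord.
- have -> : Ordinal hi = lshift m i' by exact: val_inj.
  have -> : Ordinal hj = rshift n j' by exact: val_inj.
  rewrite block_mxEur mxE stabmx_out ?ej ?leq_addr ?orbT // ei.
  by rewrite ltn_eqF // ltn_addr.
- have -> : Ordinal hi = rshift n i' by exact: val_inj.
  have -> : Ordinal hj = lshift m j' by exact: val_inj.
  rewrite block_mxEdl mxE stabmx_out ?ei ?leq_addr // ej.
  by rewrite gtn_eqF // ltn_addr.
- have -> : Ordinal hi = rshift n i' by exact: val_inj.
  have -> : Ordinal hj = rshift n j' by exact: val_inj.
  by rewrite block_mxEdr mxE stabmx_out ?ei ?leq_addr // ej eqn_add2l.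
Qed.

Lemma block_mx_inv n m (A B : 'M[R]_n) : A * B = 1 ->
  (block_mx A 0 0 1%:M : 'M_(n + m)) * block_mx B 0 0 1%:M = 1.
Proof.
move=> AB; rewrite -[LHS]/(_ *m _) mulmx_block.
rewrite !(mul0mx, mulmx0, mulmx1, addr0, add0r).
by rewrite [A *m B]AB -scalar_mx_block.
Qed.

Definition block_unit n m (A : units 'M[R]_n) : units 'M[R]_(n + m) :=
  Units (block_mx_inv m (uvalV A)) (block_mx_inv m (uVval A)).

Lemma GLn_block n m (A : units 'M[R]_n) : GLn (block_unit m A) = GLn A.
Proof. by apply: glmx_inj; rewrite /= stabmx_block. Qed.

Lemma derived_commg (G : groupType) (x y : G) : derived G (commg x y).
Proof. by move=> H [_]; apply; exists x, y. Qed.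

(** [n] and [m] are kept apart because the sizes [n + 1] and [1 + n] of the block matrices to be
    compared are not convertible. *)
Lemma K1_conj n m (A : units 'M[R]_n) (B : units 'M[R]_m)
    (X : 'M[R]_(m, n)) (Y : 'M[R]_(n, m)) :
  n = m -> X *m Y = 1%:M -> Y *m X = 1%:M -> uval B = X *m uval A *m Y ->
  qpi (derived (GL R)) (GLn A) = qpi (derived (GL R)) (GLn B).
Proof.
move=> nm; subst m => XY YX BE; pose W := @Units 'M[R]_n X Y XY YX.
have -> : B = (W * A * W^-1)%g by apply: uval_inj.
(* [A^-1 B = A^-1 W A W^-1] is the commutator of [A] and [W^-1]. *)
apply/qpiP; have := derived_commg (GLn A) (GLn W^-1)%g.
congr (derived _ _); rewrite /commg /conjg -[RHS]/(gl_mul (gl_inv _) _).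
rewrite -[LHS]/(gl_mul (gl_inv _) (gl_mul (gl_inv _) (gl_mul _ _))).
by rewrite !(GLnV, GLnM); congr GLn; apply: uval_inj; rewrite /= !mulrA.
Qed.

Lemma U_GLE (u : units R) :
  exists2 V : units 'M[R]_1, uval V = (uval u)%:M & U_GL u = GLn V.
Proof. by eexists; last reflexivity. Qed.

(* With [X = [s, 1 - st; 0, t]], of inverse [t, 0; 1 - st, s], the matrix
   [X diag(A, 1) X^-1] is [diag(1 - st + sAt, 1)]. *)
Lemma U_K1_mx_corner n (s : 'rV[R]_n) (t : 'cV[R]_n) (ts : t *m s = 1%:M) A :
  U_K1 (mx_corner ts A) = qpi (derived (GL R)) (GLn A).
Proof.
have [V VE] := U_GLE (mx_corner ts A); rewrite /U_K1 => ->.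
rewrite -(GLn_block 1 A) -(GLn_block n V); symmetry.
have es : (1%:M - s *m t) *m s = 0.
  by rewrite mulmxBl mul1mx -mulmxA ts mulmx1 subrr.
have te : t *m (1%:M - s *m t) = 0.
  by rewrite mulmxBr mulmx1 mulmxA ts mul1mx subrr.
have ee : (1%:M - s *m t) *m (1%:M - s *m t) = 1%:M - s *m t.
  by rewrite {1}mulmxBl mul1mx -mulmxA te mulmx0 subr0.
apply: (@K1_conj _ _ _ _ (block_mx s (1%:M - s *m t) 0 t)
                         (block_mx t 0 (1%:M - s *m t) s)).
- exact: addn1.
- rewrite mulmx_block !(mul0mx, mulmx0, add0r, addr0) es te ts ee.
  by rewrite addrC subrK -scalar_mx_block.
- rewrite mulmx_block !(mul0mx, mulmx0, add0r, addr0) es te ts ee.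
  by rewrite subrK -scalar_mx_block.
rewrite /= VE !mulmx_block !(mul0mx, mulmx0, mulmx1, add0r, addr0) es te ts ee.
congr block_mx.
by rewrite uval_mx_corner raddfD raddfB /= -!mx11_scalar addrC.
Qed.

End Stabilization.

(** * [K_1]-regularity and homotopy *)

Section K1Regular.
Variable R : nzRingType.

(* [meval] is a ring morphism over a noncommutative [R] only at central points. *)
Definition mpoly_ev01 (m : nat) (a : bool) : {mpoly R[m]} -> R :=
  meval (fun=> a%:R).

Lemma mpoly_ev01_additive m a : zmod_morphism (@mpoly_ev01 m a).
Proof. exact: meval_is_additive. Qed.

Lemma mpoly_ev01_multiplicative m a : monoid_morphism (@mpoly_ev01 m a).
Proof.
have com (x : R) : GRing.comm x a%:R by case: a; [exact: commr1|exact: commr0].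
have comX (x : R) (k : 'X_{1.. m}) : GRing.comm x (mmap1 (fun=> a%:R) k).
  by apply: commr_prod => i _; exact: commrX.
have [evM ev1] := @commr_mmap_is_multiplicative m R R (fun=> a%:R) idfun
  (fun _ => com) (fun p k => comX _).
by split.
Qed.

HB.instance Definition _ m a :=
  GRing.isZmodMorphism.Build _ _ (@mpoly_ev01 m a) (@mpoly_ev01_additive m a).
HB.instance Definition _ m a :=
  GRing.isMonoidMorphism.Build _ _ (@mpoly_ev01 m a) (@mpoly_ev01_multiplicative m a).

Lemma mpoly_ev01C m a (c : R) : mpoly_ev01 a (mpolyC m c) = c.
Proof. exact: mevalC. Qed.

(** Regularity concerns [{mpoly R[1]}], homotopies live in [{poly R}]; a central variable permits
    substitution from the latter into the former. *)
Lemma mpolyX_central : commr_rmorph (@mpolyC 1 R) 'X_ord0.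
Proof. by move=> c; apply/commr_sym/commr_mpolyX. Qed.

Lemma mpoly_ev01_horner a (p : {poly R}) :
  mpoly_ev01 a (horner_morph mpolyX_central p) = p.[a%:R].
Proof.
elim/poly_ind: p => [|p c IH]; first by rewrite !rmorph0 horner0.
rewrite hornerMXaddC -IH !rmorphD !rmorphM /= horner_morphX horner_morphC.
by rewrite mpoly_ev01C /mpoly_ev01 mevalXU.
Qed.

Lemma K1map_umap (S T : pzRingType) (f : {rmorphism S -> T}) (u : units S) :
  K1map f (U_K1 u) = U_K1 (umap f u).
Proof.
rewrite /U_K1 K1mapE; congr qpi; rewrite GLmap_GLn; congr GLn.
by apply: uval_inj; rewrite /= map_scalar_mx.
Qed.

Lemma units0_K1 (u : units R) : K1_regular R -> units0 R u -> U_K1 u = 1%g.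
Proof.
move=> /(_ 1) [K1inv _ invK] [w [w0 w1]].
pose W : units {mpoly R[1]} := umap (horner_morph mpolyX_central) w.
have evW (a : bool) x : uval x = (uval w).[a%:R] ->
    U_K1 x = K1inv (U_K1 W).
  move=> xE; have -> : x = umap (@mpoly_ev01 1 a) W.
    by apply: uval_inj; rewrite /= mpoly_ev01_horner.
  (* The class of [W] comes from some [y] in [K_1(R)], and either evaluation after the inclusion of
     constants is the identity, so both return [y]. *)
  rewrite -K1map_umap -[in LHS](invK (U_K1 W)); set y := K1inv _.
  have [g ->] : exists g, y = qpi (derived (GL R)) g.
    by exists (qrepr y); rewrite qreprK.
  rewrite !K1mapE; congr qpi; apply: glmx_inj; apply/funext => i.
  by apply/funext => j; exact: mpoly_ev01C.
rewrite (evW true) // -(evW false 1%g) //.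
by apply: (mulgI (U_K1 1%g)); rewrite -U_K1M !mulg1.
Qed.

End K1Regular.

(** * Injectivity of the map to [K_1(R)] *)

Section Kernel.
Variable R : nzRingType.
Variables s1 s2 t1 t2 : R.
Hypotheses (t1s1 : t1 * s1 = 1) (t2s2 : t2 * s2 = 1).
Hypotheses (t1s2 : t1 * s2 = 0) (t2s1 : t2 * s1 = 0).
Hypothesis simple : forall x : R, x != 0 -> exists a b : R, a * x * b = 1.

Let cls u : pi0U R := qpi (units0 R) u.
Let Theta n := mx_corner (isometry_colK t1s1 t2s2 t1s2 t2s1 n).

(** By minimality of the derived subgroup, it suffices that the conclusion defines a subgroup
    containing the commutators. Quantifying over all large [N] lets two elements be compared at a
    common size. *)
Lemma cls_Theta_derived (g : GL R) : derived (GL R) g ->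
  exists n, forall N, (n <= N)%N ->
    forall A : units 'M[R]_N, g = GLn A -> cls (Theta A) = 1%g.
Proof.
have ThetaM n (A B : units 'M[R]_n) :
    cls (Theta (A * B)%g) = (cls (Theta A) * cls (Theta B))%g.
  by rewrite /Theta [X in cls X]corner_unitM /cls gmulfM.
have ThetaV n (A : units 'M[R]_n) : cls (Theta A^-1%g) = (cls (Theta A))^-1%g.
  by rewrite /Theta [X in cls X](morphV_of_M (corner_unitM _)) /cls gmulfV.
move=> Dg; apply: (Dg (fun g => exists n, forall N, (n <= N)%N ->
    forall A : units 'M[R]_N, g = GLn A -> cls (Theta A) = 1%g)).
split; first split=> [|{Dg}g h [n Hg] [m Hh]|{Dg}g [n Hg]].
  - exists 0 => N _ A /esym; rewrite -[1%g]/(gl_one R) -(GLn1 _ N).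
    move=> /GLn_inj ->; apply: (mulgI (cls (Theta (uone 'M[R]_N)))).
    by rewrite mulg1 -[LHS]ThetaM; congr (cls (Theta _)); exact: mulg1.
  (* The hypotheses on [g] and [h] apply only to given representatives of size [N]; [p] and [q]
     ensure that these exist. *)
  - have [p gp] := GL_large g; have [q hq] := GL_large h.
    exists (maxn (maxn n m) (maxn p q)) => N; rewrite !geq_max.
    move=> /andP[/andP[nN mN] /andP[pN qN]] C.
    have [A gA] := gp N pN; have [B hB] := hq N qN.
    rewrite {1}gA {1}hB -[(_ * _)%g]/(gl_mul _ _) GLnM => /GLn_inj <-.
    by rewrite -[umul A B]/(A * B)%g ThetaM (Hg N) // (Hh N) // mulg1.
  - exists n => N nN A gA.
    rewrite -[A]invgK ThetaV (Hg N) ?invg1 //.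
    by rewrite -[LHS]invgK gA -[(_^-1)%g]/(gl_inv _) GLnV.
move=> _ [{Dg}g [h ->]]; have [p gp] := GL_large g; have [q hq] := GL_large h.
exists (maxn p q) => N; rewrite geq_max => /andP[/gp[A gA] /hq[B hB]] C.
have -> : commg g h = GLn (commg A B).
  rewrite gA hB /commg /conjg -[LHS]/(gl_mul (gl_inv _) (gl_mul (gl_inv _) (gl_mul _ _))).
  by rewrite !(GLnV, GLnM).
move=> /GLn_inj <-; rewrite /commg /conjg !(ThetaM, ThetaV).
rewrite (pi0_comm t1s1 t2s2 t1s2 t2s1 simple (Theta A)) mulKg.
exact: mulVg.
Qed.

Lemma U_K1_kernel u : U_K1 u = 1%g -> units0 R u.
Proof.
move=> /esym /qpiP; rewrite invg1 mul1g => /cls_Theta_derived [n Hn].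
have [V VE UV] := U_GLE u.
have := Hn (1 + n)%N (leq_addl _ _) (block_unit n V).
rewrite GLn_block => /(_ UV).
have -> : Theta (block_unit n V) = corner t1s1 u.
  apply: uval_inj; rewrite uval_corner uval_mx_corner /= VE.
  set s := isometry_row _ _ _; set t := isometry_col _ _ _.
  (* The lower block contributes the same term for [x = u] and [x = 1], so it cancels; the first
     entries of [s] and [t] are [s1] and [t1]. *)
  have stE x : (s *m block_mx x%:M 0 0 1%:M *m t) 0 0
             = s1 * x * t1 + (rsubmx (s : 'rV_(1 + n)) *m dsubmx (t : 'cV_(1 + n))) 0 0.
    rewrite -{1}(hsubmxK s) -{1}(vsubmxK t) mul_row_block.
    rewrite !(mulmx0, mulmx1, addr0, add0r) mul_row_col mxE; congr (_ + _).
    rewrite mxE big_ord1 mxE big_ord1 !mxE eqxx mulr1n /=.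
    by rewrite expr0 mul1r mulr1.
  rewrite -{1}(mulmx1 s) (scalar_mx_block _ n) !stE mulr1.
  by rewrite opprD (addrA 1) (addrC (s1 * _ * t1)) subrKA.
rewrite [X in X = _](cls_corner_id t1s1 t2s2 t1s2 t2s1 simple) => /esym /qpiP.
by rewrite invg1 mul1g.
Qed.

End Kernel.

Theorem corollary2p11 (l : fieldType) (R : algType l)
    (R_pis : purely_infinite_simple R) (R_K1reg : K1_regular R) :
  exists phi : {multiplicative pi0U R -> K1 R},
    bijective phi /\
    (forall u : units R, phi (qpi (units0 R) u) = U_K1 u).
Proof.
have [s1 [s2 [t1 [t2 [t1s1 t2s2 t1s2 t2s1]]]]] := exists_isometries R_pis.
pose f (q : pi0U R) : K1 R := U_K1 (qrepr q).
(* Regularity enters here: [u] and the chosen representative differ by an element of [U(R)^0], which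
   is trivial in [K_1(R)]. *)
have fE u : f (qpi (units0 R) u) = U_K1 u.
  have /qpiP : qpi (units0 R) u = qpi (units0 R) (qrepr (qpi (units0 R) u)).
    by rewrite qreprK.
  move=> /(units0_K1 R_K1reg); rewrite U_K1M (morphV_of_M (@U_K1M R)).
  by move=> /(canRL (mulVKg _)); rewrite mulg1.
have fM : {morph f : p q / (p * q)%g}.
  by move=> p q; rewrite -(qreprK p) -(qreprK q) -gmulfM !fE U_K1M.
pose phi : {multiplicative pi0U R -> K1 R} :=
  HB.pack f (isMultiplicative.Build _ _ f fM).
exists phi; split; last exact: fE.
have finj : injective f.
  move=> p q; rewrite -(qreprK p) -(qreprK q) !fE => pq; apply/qpiP.
  apply: (U_K1_kernel t1s1 t2s2 t1s2 t2s1 (proj2 R_pis)).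
  by rewrite U_K1M (morphV_of_M (@U_K1M R)) pq mulVg.
have fsurj y : exists q, f q = y.
  have [n [A gA]] := GLnP (qrepr y).
  (* The corner of a matrix has the same class in [K_1(R)] as the matrix. *)
  exists (qpi (units0 R) (mx_corner (isometry_colK t1s1 t2s2 t1s2 t2s1 n) A)).
  by rewrite fE U_K1_mx_corner -gA qreprK.
have [g gE] := choice fsurj.
by exists g => // q; apply: finj; rewrite gE.
Qed.
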